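(* Let $R$ be a commutative ring with nonzero identity, $\delta$ an expansion function of $\mathcal{I}(R)$, $M$ an $R$-module, $I$ an ideal of $R$ and $N$ a submodule of $M$ such that $I(+)N$ is an ideal of $R(+)M$ (that is, $IM\subseteq N$). Then $I$ is a $\delta$-$J$-ideal of $R$ if and only if $I(+)N$ is a $\delta_{(+)}$-$J$-ideal of $R(+)M$.
   Context: For a ring $R$, $\mathcal{I}(R)$ is the set of all ideals of $R$ and $J(R)$ is the Jacobson radical of $R$. An expansion function of $\mathcal{I}(R)$ is a function $\delta:\mathcal{I}(R)\to\mathcal{I}(R)$ such that $I\subseteq\delta(I)$ for every ideal $I$, and $I\subseteq K$ implies $\delta(I)\subseteq\delta(K)$ for all ideals $I,K$. A proper ideal $I$ of $R$ is a $\delta$-$J$-ideal if whenever $a,b\in R$ and $ab\in I$, then $a\in J(R)$ or $b\in\delta(I)$. $R(+)M$ is the idealization of $M$: the additive group $R\oplus M$ with multiplication $(r,m)(s,m')=(rs,rm'+sm)$; $I(+)N=\{(r,m): r\in I, m\in N\}$. The expansion $\delta_{(+)}$ is defined on ideals of $R(+)M$ of the form $I(+)N$ by $\delta_{(+)}(I(+)N)=\delta(I)(+)M$. Thus a proper ideal $I(+)N$ of $R(+)M$ is a $\delta_{(+)}$-$J$-ideal if whenever $x,y\in R(+)M$ and $xy\in I(+)N$, then $x\in J(R(+)M)$ or $y\in\delta(I)(+)M$. *)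

(* Defs.v *)
From HB Require Import structures.
From mathcomp Require Import all_boot all_algebra.
From mathcomp Require Import boolp classical_sets.

Set Implicit Arguments.
Unset Strict Implicit.
Unset Printing Implicit Defensive.

Import GRing.Theory.

Local Open Scope classical_set_scope.
Local Open Scope ring_scope.

Definition is_submodule (R : comNzRingType) (V : lmodType R) (A : set V) : Prop :=
  GRing.submod_closed [in A].

Record submodule (R : comNzRingType) (V : lmodType R) := Submodule {
  submodule_set :> set V;
  submoduleP : is_submodule submodule_set }.

(* Ideals are the submodules of the regular module; improper ones included. *)
Definition is_ideal (R : comNzRingType) (A : set R) : Prop :=
  is_submodule (A : set R^o).

Record ideal (R : comNzRingType) := Ideal {
  ideal_set :> set R;
  idealP : is_ideal ideal_set }.

Definition proper_ideal (R : comNzRingType) (I : ideal R) : Prop :=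
  (I : set R) <> setT.

Definition maximal_ideal (R : comNzRingType) (I : ideal R) : Prop :=
  proper_ideal I /\
  forall K : ideal R, proper_ideal K -> I `<=` K -> (K : set R) = I.

Definition jacobson_radical (R : comNzRingType) : set R :=
  \bigcap_(I in @maximal_ideal R) I.

Definition expansion_function (R : comNzRingType) (delta : ideal R -> ideal R) :
  Prop :=
  (forall I : ideal R, I `<=` delta I) /\
  (forall I K : ideal R, I `<=` K -> delta I `<=` delta K).

Definition delta_J_ideal (R : comNzRingType) (delta : ideal R -> ideal R)
    (I : ideal R) : Prop :=
  proper_ideal I /\
  forall a b : R,
    ideal_set I (a * b) -> jacobson_radical a \/ ideal_set (delta I) b.

(* The alias keeps the idealization product apart from the componentwise
   product structures on R * M. *)
Definition idealization (R : comNzRingType) (M : lmodType R) : Type :=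
  (R * M)%type.

HB.instance Definition _ (R : comNzRingType) (M : lmodType R) :=
  GRing.Zmodule.copy (idealization M) (R * M)%type.

Section IdealizationRing.
Variables (R : comNzRingType) (M : lmodType R).
Implicit Types x y z : idealization M.

Definition idealization_one : idealization M := (1, 0).

Definition idealization_mul x y : idealization M :=
  (x.1 * y.1, x.1 *: y.2 + y.1 *: x.2).

Fact idealization_mulA : associative idealization_mul.
Proof.
move=> [r m] [s n] [t p]; congr pair; rewrite /= ?mulrA //.
rewrite !scalerDr !scalerA addrA; congr (_ + _ *: _ + _ *: _).
  exact: mulrC.
by rewrite mulrC.
Qed.

Fact idealization_mulC : commutative idealization_mul.
Proof. by move=> [r m] [s n]; congr pair; rewrite /= 1?mulrC 1?addrC. Qed.

Fact idealization_mul1 : left_id idealization_one idealization_mul.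
Proof.
by move=> [r m]; congr pair; rewrite /= ?mul1r // scale1r scaler0 addr0.
Qed.

Fact idealization_mulDl : left_distributive idealization_mul +%R.
Proof.
move=> [r m] [s n] [t p]; congr pair; rewrite /= ?mulrDl //.
by rewrite scalerDl scalerDr addrACA.
Qed.

Fact idealization_one_neq0 : idealization_one != 0.
Proof. by apply/eqP => -[/eqP]; rewrite oner_eq0. Qed.

HB.instance Definition _ :=
  GRing.Zmodule_isComNzRing.Build (idealization M) idealization_mulA
    idealization_mulC idealization_mul1 idealization_mulDl
    idealization_one_neq0.

End IdealizationRing.

Definition idealization_set (R : comNzRingType) (M : lmodType R)
    (A : set R) (B : set M) : set (idealization M) := A `*` B.

(* The ideals of the idealization of the form I(+)N, as pairs (I, N). *)
Record homogeneous_ideal (R : comNzRingType) (M : lmodType R) :=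
  HomogeneousIdeal {
    hideal_fst : ideal R;
    hideal_snd : submodule M;
    hidealP : is_ideal (idealization_set hideal_fst hideal_snd) }.

Definition ideal_of_homogeneous (R : comNzRingType) (M : lmodType R)
    (K : homogeneous_ideal M) : ideal (idealization M) :=
  Ideal (hidealP K).

Coercion ideal_of_homogeneous : homogeneous_ideal >-> ideal.

Fact is_submoduleT (R : comNzRingType) (M : lmodType R) :
  is_submodule [set: M].
Proof. by split=> [|a u v _ _]; rewrite inE. Qed.

Fact is_ideal_idealizationT (R : comNzRingType) (M : lmodType R)
    (I : ideal R) :
  is_ideal (idealization_set I (Submodule (is_submoduleT M))).
Proof.
have [I0 Il] := idealP I; split; first by rewrite inE; split=> //; exact: set_mem.
move=> a u v /set_mem[/= Iu _] /set_mem[/= Iv _]; apply/mem_set; split=> //=.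
by apply/set_mem; apply: (Il a.1 u.1 v.1); apply: mem_set.
Qed.

Definition delta_plus (R : comNzRingType) (M : lmodType R)
    (delta : ideal R -> ideal R) (K : homogeneous_ideal M) :
  homogeneous_ideal M :=
  HomogeneousIdeal (is_ideal_idealizationT M (delta (hideal_fst K))).

Definition delta_plus_J_ideal (R : comNzRingType) (M : lmodType R)
    (delta : ideal R -> ideal R) (K : homogeneous_ideal M) : Prop :=
  proper_ideal K /\
  forall x y : idealization M,
    ideal_set K (x * y) -> jacobson_radical x \/ ideal_set (delta_plus delta K) y.

(* Main.v *)
Require Import Defs.
From mathcomp Require Import all_boot all_algebra.
From mathcomp Require Import boolp classical_sets.

(** The condition defining a [delta]-J-ideal [I] and the one defining a
    [delta_plus]-J-ideal [I(+)N] both reduce to first components, because the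
    Jacobson radical of the idealization is [J(R)(+)M]
    ([jacobson_radical_idealization]).  Granting this, a pair [a, b] in [R] is
    tested on [(a, 0)] and [(b, 0)], and a pair [x, y] in the idealization is
    tested on [x.1] and [y.1]; properness transfers since [I(+)N] contains the
    unit [(1, 0)] exactly when [I] contains [1].

    To compute the radical, projecting an ideal [K] to [R] and extending an
    ideal [Q] to [Q(+)M] are adjoint: [K] lies in [Q(+)M] iff the projection of
    [K] lies in [Q].  Both maps preserve properness; for the projection this is
    where [M] squaring to zero enters, as [(1, m)] is a unit with inverse
    [(1, - m)].  Hence they restrict to mutually inverse bijections between the
    maximal ideals of the two rings, so every maximal ideal of the
    idealization has the form [Q(+)M] with [Q] maximal. *)

Set Implicit Arguments.
Unset Strict Implicit.
Unset Printing Implicit Defensive.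

Import GRing.Theory.
(* [proper_ideal] also names a predicate of quotient-ring theory; the ideals
   here are set-based ones, so their definitions must take precedence. *)
Import Defs.

Local Open Scope classical_set_scope.
Local Open Scope ring_scope.

Lemma is_idealP (R : comNzRingType) (A : set R) :
  is_ideal A <-> A 0 /\ forall a u v, A u -> A v -> A (a * u + v).
Proof.
split=> -[A0 Al]; split; first exact: set_mem.
- by move=> a u v Au Av; apply/set_mem; apply: (Al a u v); apply: mem_set.
- exact: mem_set.
- by move=> a u v /set_mem Au /set_mem Av; apply/mem_set; apply: Al.
Qed.

Lemma ideal_mulr (R : comNzRingType) (I : ideal R) (a u : R) :
  ideal_set I u -> ideal_set I (a * u).
Proof.
move=> Iu; have [I0 Il] := (is_idealP _).1 (idealP I).
by rewrite -[a * u]addr0; apply: Il.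
Qed.

Lemma proper_idealP (R : comNzRingType) (I : ideal R) :
  proper_ideal I <-> ~ ideal_set I 1.
Proof.
split=> [pI I1|nI1 IT]; last by apply: nI1; rewrite IT.
apply: pI; apply/seteqP; split=> // a _.
by rewrite -[a]mulr1; apply: ideal_mulr.
Qed.

Section ProjectionExtension.
Variables (R : comNzRingType) (M : lmodType R).
Implicit Types (K : ideal (idealization M)) (Q : ideal R).

Definition base_set (A : set (idealization M)) : set R :=
  [set r | exists m : M, A (r, m)].

Fact is_ideal_base K : is_ideal (base_set K).
Proof.
have [K0 Kl] := (is_idealP _).1 (idealP K).
apply/is_idealP; split; first by exists 0.
move=> a u v [m Km] [n Kn]; exists (a *: m + u *: 0 + n).
exact: (Kl (a, 0) _ _ Km Kn).
Qed.

Definition base_ideal K : ideal R := Ideal (is_ideal_base K).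

Definition extended_ideal Q : ideal (idealization M) :=
  Ideal (is_ideal_idealizationT M Q).

Lemma sub_extended_base K Q :
  (K `<=` extended_ideal Q) <-> (base_ideal K `<=` Q).
Proof.
split=> sKQ; first by move=> r [m /sKQ[]].
by move=> [r m] Krm; split=> //; apply: sKQ; exists m.
Qed.

Lemma base_extended Q : base_ideal (extended_ideal Q) = Q :> set R.
Proof. by apply/seteqP; split=> r; [case=> m [] | exists 0]. Qed.

(** An element [(1, m)] of [K] is a unit, because
    [(1, - m) * (1, m) = (1, 0)]. *)
Lemma proper_base K : proper_ideal K -> proper_ideal (base_ideal K).
Proof.
move=> /proper_idealP nK1; apply/proper_idealP => -[m K1m]; apply: nK1.
suff <- : ((1, - m) : idealization M) * ((1, m) : idealization M) = 1.
  exact: ideal_mulr.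
by congr pair; rewrite /= ?mulr1 // !scale1r addrN.
Qed.

Lemma proper_extended Q : proper_ideal Q -> proper_ideal (extended_ideal Q).
Proof.
by move=> /proper_idealP nQ1; apply/proper_idealP => -[Q1 _]; apply: nQ1.
Qed.

Lemma maximal_extended Q :
  maximal_ideal Q -> maximal_ideal (extended_ideal Q).
Proof.
move=> [pQ maxQ]; split; first exact: proper_extended.
move=> L pL sQL; apply/seteqP; split=> //.
apply/sub_extended_base; rewrite (maxQ _ (proper_base pL)) // => r Qr.
by exists 0; apply: sQL.
Qed.

(** [K] lies in the proper ideal [base_ideal K (+) M], hence equals it. *)
Lemma extended_base K :
  maximal_ideal K -> extended_ideal (base_ideal K) = K :> set _.
Proof.
move=> [pK maxK]; apply: maxK; first exact/proper_extended/proper_base.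
exact/sub_extended_base.
Qed.

Lemma maximal_base K : maximal_ideal K -> maximal_ideal (base_ideal K).
Proof.
move=> [pK maxK]; split; first exact: proper_base.
move=> Q pQ /sub_extended_base sKQ.
rewrite -base_extended; congr base_set.
exact: (maxK _ (proper_extended pQ) sKQ).
Qed.

Lemma jacobson_radical_idealization (x : idealization M) :
  jacobson_radical x <-> jacobson_radical x.1.
Proof.
split=> Jx.
  by move=> Q /maximal_extended /Jx[].
move=> K maxK; rewrite -(extended_base maxK); split=> //.
exact/Jx/maximal_base.
Qed.

End ProjectionExtension.

Theorem proposition2p9 (R : comNzRingType) (delta : ideal R -> ideal R)
    (hdelta : expansion_function delta) (M : lmodType R)
    (I : ideal R) (N : submodule M)
    (hIN : is_ideal (idealization_set I N)) :
  delta_J_ideal delta I <->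
  delta_plus_J_ideal delta (HomogeneousIdeal hIN).
Proof.
have N0 : submodule_set N 0 by apply/set_mem; case: (submoduleP N).
have properE : proper_ideal I <-> proper_ideal (HomogeneousIdeal hIN).
  split=> /proper_idealP pI; apply/proper_idealP => I1; apply: pI => //.
  by case: I1.
split=> -[/properE pI JI]; split=> //.
- move=> x y [/= Ixy _].
  case: (JI _ _ Ixy) => [Jx|dy]; last by right.
  by left; apply/jacobson_radical_idealization.
- move=> a b Iab.
  have INab : ideal_set (HomogeneousIdeal hIN)
      (((a, 0) : idealization M) * ((b, 0) : idealization M)).
    by split; rewrite //= !scaler0 addr0.
  case: (JI _ _ INab) => [/jacobson_radical_idealization Ja|[db _]].
    by left.
  by right.
Qed.
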